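(* Let $(X,d_X)$ and $(Y,d_Y)$ be nonempty geodesic metric spaces and let $\Phi:X\to Y$ be a weak similarity. Then $\Phi$ is a similarity and, if $X$ and $Y$ are bounded with $\min\{\operatorname{diam}X,\operatorname{diam}Y\}>0$, then the ratio $r(\Phi)$ equals $\dfrac{\operatorname{diam}Y}{\operatorname{diam}X}$.
   Context: The distance set of a nonempty metric space is $D(X)=\{d(x,y):x,y\in X\}$. A surjective mapping $\Phi:X\to Y$ between nonempty metric spaces is a weak similarity if there is a strictly increasing function $f:D(Y)\to D(X)$ such that $d_X(x,y)=f(d_Y(\Phi(x),\Phi(y)))$ for all $x,y\in X$. A mapping $\Phi:X\to Y$ is a similarity if it is bijective and there is $r=r(\Phi)>0$ (the ratio) with $d_Y(\Phi(x),\Phi(y))=r\,d_X(x,y)$ for all $x,y\in X$. A geodesic path in a metric space $(X,d)$ is a path $\gamma:[a,b]\to X$, $-\infty<a<b<\infty$, with $d(\gamma(t_1),\gamma(t_2))=|t_2-t_1|$ for all $t_1,t_2\in[a,b]$; it joins $\gamma(a)$ and $\gamma(b)$. A metric space is geodesic if every two distinct points are joined by a geodesic path in it. *)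

(* Defs.v *)
From mathcomp Require Import all_boot all_order all_algebra.
From mathcomp Require Import all_classical all_reals all_analysis.

Set Implicit Arguments.
Unset Strict Implicit.
Unset Printing Implicit Defensive.

Import Order.TTheory GRing.Theory Num.Theory.
Import numFieldTopology.Exports.

Local Open Scope classical_set_scope.
Local Open Scope ring_scope.

Definition distance_set (R : realType) (X : metricType R) : set R :=
  [set r | exists x y : X, r = mdist x y].

Definition bounded_metric (R : realType) (X : metricType R) : Prop :=
  has_ubound (distance_set X).

(* [sup] takes the junk value 0 on sets without an upper bound, so this is the
   diameter only when [X] is nonempty and [bounded_metric X] holds. *)
Definition diam (R : realType) (X : metricType R) : R :=
  sup (distance_set X).

(* A function D(Y) -> D(X) is represented by a total function on R of which only
   the restriction to D(Y) is constrained. *)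
Definition weak_similarity (R : realType) (X Y : metricType R)
    (Phi : X -> Y) : Prop :=
  set_surj [set: X] [set: Y] Phi /\
  exists f : R -> R,
    [/\ set_fun (distance_set Y) (distance_set X) f,
        {in distance_set Y &, {homo f : s t / s < t}} &
        forall x y : X, mdist x y = f (mdist (Phi x) (Phi y))].

(* The ratio is a relation, since it is not determined by [Phi] when [X] is a
   single point. *)
Definition is_ratio (R : realType) (X Y : metricType R)
    (Phi : X -> Y) (r : R) : Prop :=
  0 < r /\ forall x y : X, mdist (Phi x) (Phi y) = r * mdist x y.

Definition similarity (R : realType) (X Y : metricType R)
    (Phi : X -> Y) : Prop :=
  bijective Phi /\ exists r : R, is_ratio Phi r.

(* A path [a, b] -> X is represented by a total function on R of which only the
   restriction to [a, b] is constrained. *)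
Definition geodesic_path (R : realType) (X : metricType R)
    (a b : R) (gamma : R -> X) : Prop :=
  [/\ a < b,
      {within `[a, b], continuous gamma} &
      {in `[a, b] &, forall t1 t2 : R,
         mdist (gamma t1) (gamma t2) = `|t2 - t1|}].

Definition geodesic_space (R : realType) (X : metricType R) : Prop :=
  forall x y : X, x <> y ->
    exists (a b : R) (gamma : R -> X),
      [/\ geodesic_path a b gamma, gamma a = x & gamma b = y].

(* Main.v *)
Require Import Defs.
From mathcomp Require Import all_boot all_order all_algebra.
From mathcomp Require Import all_classical all_reals all_analysis.
From mathcomp Require Import ring lra.

Set Implicit Arguments.
Unset Strict Implicit.
Unset Printing Implicit Defensive.

Import Order.TTheory GRing.Theory Num.Theory.

Local Open Scope classical_set_scope.
Local Open Scope ring_scope.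

                                                                            
                                                                              
                                                                               
                                                                                
                                                                         
                                                                               
                                                                           
             

(** A weak similarity changes distances by an increasing [f], so it suffices that [f] is linear.
    Geodesics in Y make every number between 0 and a distance again a distance. Splitting a geodesic
    of Y gives subadditivity of [f] through the triangle inequality in X; splitting a geodesic of X
    rules out strict inequality ([weak_similarity_scale_add]). A monotone additive function on a
    bounded interval is linear ([monotone_additive_linear]), so all pairs of distances have the same
    quotient, which is the ratio; diameters scale with it. *)

Lemma mulr_exp2_le_eq0 (R : archiRealFieldType) (x c : R) :
  (forall n, `|x| * 2 ^+ n <= c) -> x = 0.
Proof.
move=> xc; apply/eqP/contraT => x0.
have nx0 : 0 < `|x| by rewrite normr_gt0.
have c0 : 0 <= c by apply: le_trans (xc 0%N); rewrite expr0 mulr1 ltW.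
have := archi_boundP (divr_ge0 c0 (ltW nx0)).
set n := Num.bound _ => cn.
have := xc n; rewrite mulrC -ler_pdivlMr // leNgt (lt_trans cn) //.
by rewrite -natrX ltr_nat ltn_expl.
Qed.

                                                                              
                                                                        
(** Replace [b] by [b / 2] and reduce [a] modulo [b / 2]. By additivity the cross difference is
    twice the new one, while [b * f b] is four times its new value, so each halving gains a factor
    2. *)
Lemma monotone_additive_bisection (R : realFieldType) (f : R -> R) (c : R)
    (f_mono : forall s t, 0 <= s -> s <= t -> t <= c -> f s <= f t)
    (f_add : forall s t, 0 <= s -> 0 <= t -> s + t <= c ->
      f (s + t) = f s + f t) (n : nat) (a b : R) :
  0 <= a -> a <= b -> b <= c ->
  `|b * f a - a * f b| * 2 ^+ n <= b * f b.
Proof.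
elim: n a b => [|n IHn] a b a0 ab bc.
  (* With [f 0 = 0], monotonicity puts both products between 0 and [b * f b]. *)
  have f0 : f 0 = 0.
    by have := f_add 0 0 (lexx _) (lexx _); rewrite addr0 => /(_ _); lra.
  have fa0 : 0 <= f a by rewrite -f0; apply: f_mono => //; lra.
  have fab : f a <= f b by apply: f_mono.
  have b0 := le_trans a0 ab; have fb0 := le_trans fa0 fab.
  have := ler_wpM2l b0 fab; have := ler_wpM2r fb0 ab.
  have := mulr_ge0 b0 fa0; have := mulr_ge0 a0 fb0.
  by rewrite expr0 mulr1 ler_norml; lra.
have fb : f b = f (b / 2) + f (b / 2) by rewrite -f_add -?splitr //; lra.
have half a' : 0 <= a' -> a' <= b / 2 ->
    b * f a - a * f b = 2 * (b / 2 * f a' - a' * f (b / 2)) ->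
    `|b * f a - a * f b| * 2 ^+ n.+1 <= b * f b.
  move=> a'0 a'b ->; rewrite normrM ger0_norm // exprS fb.
  have := IHn a' (b / 2) a'0 a'b; set N := `|_| * 2 ^+ n.
  set N' := 2 * _ * _; have -> : N' = 4 * N by rewrite /N' /N; ring.
  by move=> /(_ _); lra.
have [ah|ha] := leP a (b / 2).
  by apply: (half a) => //; rewrite fb; field.
have fa : f a = f (a - b / 2) + f (b / 2) by rewrite -f_add ?subrK //; lra.
by apply: (half (a - b / 2)); rewrite ?fa ?fb; [lra|lra|field].
Qed.

Lemma monotone_additive_linear (R : archiRealFieldType) (f : R -> R) (b : R)
    (f_mono : forall s t, 0 <= s -> s <= t -> t <= b -> f s <= f t)
    (f_add : forall s t, 0 <= s -> 0 <= t -> s + t <= b ->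
      f (s + t) = f s + f t) (a : R) :
  0 <= a -> a <= b -> b * f a = a * f b.
Proof.
move=> a0 ab; apply/subr0_eq/mulr_exp2_le_eq0 => n.
exact: monotone_additive_bisection f_mono f_add n _ _ a0 ab (lexx b).
Qed.

(** The geodesic hypotheses are used only through this form, which includes the degenerate case
    [x = y]. *)
Lemma geodesic_split (R : realType) (X : metricType R) (x y : X) (s : R) :
  geodesic_space X -> 0 <= s -> s <= mdist x y ->
  exists z, mdist x z = s /\ mdist z y = mdist x y - s.
Proof.
move=> geoX s0 sxy; have [xy|/eqP xy] := eqVneq x y.
  move: sxy; rewrite -xy mdistxx => s1; exists x.
  by rewrite mdistxx; split; lra.
have [a [b [g [[ab _ gE] ga gb]]]] := geoX _ _ xy.
have aI : a \in `[a, b] by rewrite in_itv/= lexx ltW.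
have bI : b \in `[a, b] by rewrite in_itv/= lexx ltW.
have xyE : mdist x y = b - a by rewrite -ga -gb gE // gtr0_norm ?subr_gt0.
have sI : a + s \in `[a, b] by rewrite in_itv/=; lra.
exists (g (a + s)); rewrite xyE -ga -gb !gE //.
by split; [rewrite ger0_norm; lra|rewrite ger0_norm; lra].
Qed.

Section weak_similarity_scale.
Variables (R : realType) (X Y : metricType R) (Phi : X -> Y) (f : R -> R).
Hypotheses (geoX : geodesic_space X) (geoY : geodesic_space Y).
Hypothesis Phi_surj : set_surj [set: X] [set: Y] Phi.
Hypothesis f_incr : {in distance_set Y &, {homo f : s t / s < t}}.
Hypothesis fE : forall x y : X, mdist x y = f (mdist (Phi x) (Phi y)).

Let surj y : exists x, Phi x = y.
Proof. by have [x _ <-] := Phi_surj (I : [set: Y] y); exists x. Qed.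

(** Strict monotonicity on a totally ordered set also reflects the order, so comparisons of
    distances pass both ways between X and Y. *)
Let f_ltE (x y x' y' : Y) :
  (f (mdist x y) < f (mdist x' y')) = (mdist x y < mdist x' y').
Proof.
have D (u v : Y) : mdist u v \in distance_set Y by rewrite inE; exists u, v.
apply/idP/idP => [|/f_incr]; last by apply.
by apply: contraTT; rewrite -!leNgt le_eqVlt => /predU1P[->//|/f_incr/ltW]; apply.
Qed.

Lemma weak_similarity_bij : bijective Phi.
Proof.
rewrite -setTT_bijective; split => // x y _ _ xy.
(* Equal images give [mdist x y = f 0 = mdist y y = 0]. *)
by apply: mdist_positivity; rewrite fE xy -fE mdistxx.
Qed.

(** [f] is controlled only on distances of Y, so [s] and [t] must first be realised as such. *)
Lemma weak_similarity_scale_mono (x y : X) (s t : R) :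
  0 <= s -> s <= t -> t <= mdist (Phi x) (Phi y) -> f s <= f t.
Proof.
move=> s0 st txy; have [z [zE _]] := geodesic_split geoY (le_trans s0 st) txy.
have [z' [z'E _]] := geodesic_split geoY s0 (le_trans st txy).
by rewrite -zE -z'E leNgt f_ltE -leNgt zE z'E.
Qed.

Lemma weak_similarity_scale_add (x y : X) (s t : R) :
  0 <= s -> 0 <= t -> s + t <= mdist (Phi x) (Phi y) -> f (s + t) = f s + f t.
Proof.
move=> s0 t0 stxy; have st0 := addr_ge0 s0 t0.
(* Move [y] so that its image is at distance exactly [s + t] from that of [x], then take [z] whose
   image splits this distance into [s] and [t]. *)
have {stxy} [w [xw _]] := geodesic_split geoY st0 stxy.
have [{}y yw] := surj w; have {xw} xy : mdist (Phi x) (Phi y) = s + t.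
  by rewrite yw.
have sxy : s <= mdist (Phi x) (Phi y) by lra.
have [w' [xz zy']] := geodesic_split geoY s0 sxy.
have [z zw] := surj w'; rewrite -zw in xz zy' => {w' zw}.
have zy : mdist (Phi z) (Phi y) = t by lra.
rewrite -xy -[in f s]xz -zy -!fE; apply/eqP; rewrite eq_le metric_triangle /=.
(* If the triangle inequality in X were strict, the point [p] of a geodesic from [x] to [y] with
   [mdist x p = mdist x z] would be closer to [y] than [z] is. Carried to Y, this bounds the path
   through [Phi p] strictly below [s + t]. *)
rewrite leNgt; apply/negP => lt_xy.
have xz_xy : mdist x z <= mdist x y by rewrite !fE leNgt f_ltE -leNgt xz.
have [p [xp py]] := geodesic_split geoX (mdist_ge0 x z) xz_xy.
have : mdist (Phi p) (Phi y) < mdist (Phi z) (Phi y).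
  by rewrite -f_ltE -!fE py; lra.
have : mdist (Phi x) (Phi p) <= mdist (Phi x) (Phi z).
  by rewrite leNgt -f_ltE -!fE xp ltxx.
by have := metric_triangle (Phi x) (Phi p) (Phi y); lra.
Qed.

(** This is linearity of [f] up to the larger of the two distances, in product form so that zero
    distances are allowed. *)
Lemma weak_similarity_scale_cross (x y x' y' : X) :
  mdist (Phi x) (Phi y) * mdist x' y' = mdist (Phi x') (Phi y') * mdist x y.
Proof.
wlog le_xy : x y x' y' / mdist (Phi x') (Phi y') <= mdist (Phi x) (Phi y).
  move=> IH; have [/IH//|/ltW/IH//] :=
    leP (mdist (Phi x') (Phi y')) (mdist (Phi x) (Phi y)).
rewrite !fE; apply: monotone_additive_linear; rewrite ?mdist_ge0 //.
- exact: weak_similarity_scale_mono.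
- exact: weak_similarity_scale_add.
Qed.

Lemma weak_similarity_ratio : exists r, is_ratio Phi r.
Proof.
have inj := bij_inj weak_similarity_bij.
have [[x [y xy]]|triv] := pselect (exists x y : X, x != y); last first.
  (* On a single point every positive number is a ratio. *)
  exists 1; split=> // x y.
  have -> : x = y by apply: contra_notP triv => /eqP; exists x, y.
  by rewrite !mdistxx mulr0.
have dX : 0 < mdist x y by rewrite mdist_gt0.
have dY : 0 < mdist (Phi x) (Phi y) by rewrite mdist_gt0 (inj_eq inj).
exists (mdist (Phi x) (Phi y) / mdist x y); split; first exact: divr_gt0.
move=> x' y'; rewrite mulrAC weak_similarity_scale_cross mulfK //.
by rewrite gt_eqF.
Qed.

End weak_similarity_scale.

(** By surjectivity the distances of Y are exactly [r] times those of X; boundedness makes both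
    suprema genuine. *)
Lemma diam_ratio (R : realType) (X Y : metricType R) (Phi : X -> Y) (r : R) :
  [set: X] !=set0 -> set_surj [set: X] [set: Y] Phi ->
  bounded_metric X -> bounded_metric Y -> is_ratio Phi r ->
  diam Y = r * diam X.
Proof.
move=> [x0 _] Phi_surj bX bY [r0 rE]; apply/eqP; rewrite eq_le; apply/andP; split.
- apply: ge_sup; first by exists (mdist (Phi x0) (Phi x0)), (Phi x0), (Phi x0).
  move=> _ [y [y' ->]].
  have [x _ <-] := Phi_surj y I; have [x' _ <-] := Phi_surj y' I.
  by rewrite rE ler_pM2l //; apply: ub_le_sup => //; exists x, x'.
- rewrite mulrC -ler_pdivlMr //.
  apply: ge_sup; first by exists (mdist x0 x0), x0, x0.
  move=> _ [x [x' ->]]; rewrite ler_pdivlMr // mulrC -rE.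
  by apply: ub_le_sup => //; exists (Phi x), (Phi x').
Qed.

Theorem theorem4p7 (R : realType) (X Y : metricType R) (Phi : X -> Y)
  (X0 : [set: X] !=set0) (Y0 : [set: Y] !=set0)
  (geoX : geodesic_space X) (geoY : geodesic_space Y)
  (wsPhi : weak_similarity Phi) :
  similarity Phi /\
  (bounded_metric X -> bounded_metric Y -> 0 < Num.min (diam X) (diam Y) ->
   forall r : R, is_ratio Phi r -> r = diam Y / diam X).
Proof.
have [Phi_surj [f [_ f_incr fE]]] := wsPhi.
split; first split.
- exact: weak_similarity_bij fE.
- exact: weak_similarity_ratio fE.
- move=> bX bY; rewrite lt_min => /andP[dX _] r r_ratio.
  by rewrite (diam_ratio X0 Phi_surj bX bY r_ratio) mulfK // gt_eqF.
Qed.
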